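(* Let $U\subseteq\mathbb Z$ be infinite and let $\sigma\colon\mathbb N\to U$ be a bijection, where $\mathbb N=\{1,2,3,\dots\}$. For any integers $a_0,a_1,a_2,\ldots$, the function $$f(x)=\sum_{k=0}^{\infty}a_k\prod_{i=1}^k (x-\sigma(i))$$ (which, for each $x\in U$, has only finitely many nonzero terms) belongs to $LIP(U)$. Moreover, every function in $LIP(U)$ is of this form for a unique sequence of integers $(a_k)_{k\ge 0}$.
   Context: For an infinite $U\subseteq\mathbb Z$, a function $f\colon U\to\mathbb Z$ is LIP on $U$ if for every finite $X\subseteq U$ there is $p\in\mathbb Z[x]$ with $p(x)=f(x)$ for all $x\in X$; $LIP(U)$ is the set of all such functions. *)

(* Defs.v *)
From HB Require Import structures.
From mathcomp Require Import all_boot all_order all_algebra.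
From mathcomp Require Import all_classical.

Set Implicit Arguments.
Unset Strict Implicit.
Unset Printing Implicit Defensive.

Import Order.TTheory GRing.Theory Num.Theory.
Local Open Scope classical_set_scope.
Local Open Scope ring_scope.

(* A set [U : set int] used as a type is the subtype of its elements, so a
   function on [U] has type [U -> int]. *)
Definition LIP (U : set int) : set (U -> int) :=
  [set f | forall X : set U, finite_set X ->
     exists p : {poly int}, forall x : U, X x -> p.[set_val x] = f x].

(* The value [sigma 0] is never used: the product runs over 1 <= i <= k. *)
Definition newton_term (sigma : nat -> int) (a : nat -> int) (x : int)
    (k : nat) : int :=
  a k * \prod_(1 <= i < k.+1) (x - sigma i).

(* [\sum_(k \in A)] is the sum of a family with finite support; it is 0 by
   convention when the support is infinite. *)
Definition newton_series (U : set int) (sigma : nat -> int) (a : nat -> int) :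
    U -> int :=
  fun x => \sum_(k \in [set: nat]) newton_term sigma a (set_val x) k.

(* Main.v *)
(* The Newton polynomials vanish at sigma 1, ..., sigma k from index k on, so the
   series restricted to finitely many points is a polynomial.  Conversely,
   dividing an interpolating polynomial successively by the monic factors
   'X - sigma i gives integral Newton coefficients; the system they solve is
   triangular with nonzero diagonal, so the coefficients obtained for different
   finite sets agree. *)
Require Import Defs.
From HB Require Import structures.
From mathcomp Require Import all_boot all_order all_algebra.
From mathcomp Require Import all_classical.

Set Implicit Arguments.
Unset Strict Implicit.
Unset Printing Implicit Defensive.

Import Order.TTheory GRing.Theory Num.Theory.
Local Open Scope classical_set_scope.
Local Open Scope ring_scope.

Lemma newton_term_eq0 (s a : nat -> int) (m k : nat) :
  (0 < m <= k)%N -> newton_term s a (s m) k = 0.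
Proof.
move=> /andP[m_gt0 le_mk]; apply/eqP; rewrite mulf_eq0; apply/orP; right.
by rewrite prodf_seq_eq0; apply/hasP; exists m;
  rewrite ?subrr //= mem_index_iota m_gt0.
Qed.

Lemma newton_term_polyE (s a : nat -> int) (x : int) (k : nat) :
  (a k *: \prod_(1 <= i < k.+1) ('X - (s i)%:P)).[x] = newton_term s a x k.
Proof.
by rewrite hornerZ horner_prod; congr (_ * _); apply: eq_bigr => i _; rewrite !hornerE.
Qed.

Lemma newton_sum_widen (s a : nat -> int) (m n : nat) : (0 < m <= n)%N ->
  \sum_(k < n) newton_term s a (s m) k = \sum_(k < m) newton_term s a (s m) k.
Proof.
move=> /andP[m_gt0 le_mn].
rewrite -!(big_mkord xpredT (newton_term s a (s m))) (big_cat_nat (n := m)) //=.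
rewrite [X in _ + X]big_nat [X in _ + X]big1 ?addr0 // => k /andP[le_mk _].
by rewrite newton_term_eq0 ?m_gt0.
Qed.

(** The factor [x - s m] kills every term from index [m] on, so the support is finite and the
    default value 0 never arises. Leaving [n] free lets one truncation serve several points. *)
Lemma newton_series_sum (U : set int) (s a : nat -> int) (x : U) (m n : nat) :
  (0 < m <= n)%N -> set_val x = s m ->
  newton_series s a x = \sum_(k < n) newton_term s a (s m) k.
Proof.
move=> /andP[m_gt0 le_mn] xE; rewrite /newton_series xE fsbig_ord.
apply/esym/fsbig_widen => // k [_ /= /negP]; rewrite -leqNgt => le_nk.
by rewrite newton_term_eq0 ?m_gt0 ?(leq_trans le_mn).
Qed.

(** Induction on [n]: the remainder of [q] modulo the monic ['X - s n.+1] is the integer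
    [q.[s n.+1]], which becomes coefficient [n]; the quotient [r] is carried on. *)
Lemma newton_expansion (s : nat -> int) (p : {poly int}) (n : nat) :
  exists (a : nat -> int) (q : {poly int}),
    p = \sum_(k < n) a k *: \prod_(1 <= i < k.+1) ('X - (s i)%:P)
        + q * \prod_(1 <= i < n.+1) ('X - (s i)%:P).
Proof.
elim: n => [|n [a [q ->]]].
  by exists (fun=> 0), p; rewrite big_ord0 big_geq // mulr1 add0r.
have /factor_theorem[r rE] : root (q - q.[s n.+1]%:P) (s n.+1).
  by rewrite /root !hornerE subrr.
exists (fun k => if k == n then q.[s n.+1] else a k), r.
rewrite big_ord_recr /= eqxx -addrA; congr (_ + _).
  by apply: eq_bigr => i _; rewrite ltn_eqF.
rewrite [X in r * X]big_nat_recr //= [X in r * X]mulrC mulrA -rE.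
by rewrite mulrBl mul_polyC addrC subrK.
Qed.

(** At [s k.+1] the terms below [k] cancel by induction, leaving [a k] and [b k] times the same
    product, nonzero by injectivity. *)
Lemma newton_coef_inj (s a b : nat -> int) (n : nat) :
  {in [set m | (0 < m)%N] &, injective s} ->
  (forall m, (0 < m <= n)%N ->
     \sum_(k < m) newton_term s a (s m) k = \sum_(k < m) newton_term s b (s m) k) ->
  forall k, (k < n)%N -> a k = b k.
Proof.
move=> s_inj eq_ab; elim/ltn_ind => k IHk lt_kn.
have := eq_ab k.+1 lt_kn; rewrite !big_ord_recr /=.
under eq_bigr => i _ do rewrite /newton_term IHk ?(ltn_trans _ lt_kn) //.
move=> /addrI; apply: mulIf; rewrite prodf_seq_neq0; apply/allP => i /=.
rewrite mem_index_iota => /andP[i_gt0 lt_ik]; rewrite subr_eq0; apply/eqP => eq_s.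
have eq_ki := s_inj _ _ (mem_set (ltn0Sn k)) (mem_set i_gt0) eq_s.
by rewrite -eq_ki ltnn in lt_ik.
Qed.

Theorem theorem1 (U : set int) (sigma : nat -> int)
  (U_infinite : infinite_set U)
  (sigma_bij : set_bij [set n : nat | (0 < n)%N] U sigma) :
  (forall a : nat -> int,
     (forall x : U,
        finite_set [set k : nat | newton_term sigma a (set_val x) k != 0]) /\
     LIP (@newton_series U sigma a)) /\
  (forall f : U -> int, LIP f ->
     exists! a : nat -> int, f = @newton_series U sigma a).
Proof.
case: sigma_bij => sigmaU sigma_inj sigma_surj.
have /choice[rank rankP] (x : U) :
    exists m, (0 < m)%N /\ set_val x = sigma m.
  have [m m_gt0 mE] := sigma_surj _ (set_valP x).
  by exists m.
(* [u] enumerates the points of [U] from 0, hence the shift to [sigma m.+1]. *)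
have /choice[u uE] (m : nat) : exists x : U, set_val x = sigma m.+1.
  have Um : U (sigma m.+1) by exact: sigmaU.
  by exists (SigSub (mem_set Um)).
split=> [a|f fLIP].
  split=> [x|X /finite_seqP[r ->]].
    apply: (@sub_finite_set _ _ `I_(rank x)) => // k /= /eqP; rewrite ltnNge.
    have [rank_gt0 ->] := rankP x; apply: contra_notN => le_k.
    by rewrite newton_term_eq0 ?rank_gt0.
  (* Beyond the largest rank all terms vanish at every point of [r], so one polynomial fits them
     all. *)
  pose n := (\max_(x <- r) rank x)%N.
  exists (\sum_(k < n) a k *: \prod_(1 <= i < k.+1) ('X - (sigma i)%:P)).
  move=> x /= xr; have [rank_gt0 xE] := rankP x.
  rewrite (newton_series_sum _ _ xE (n := n)) ?rank_gt0 ?leq_bigmax_seq //.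
  by rewrite horner_sum xE; apply: eq_bigr => k _; rewrite newton_term_polyE.
have seriesE a m : newton_series sigma a (u m)
    = \sum_(k < m.+1) newton_term sigma a (sigma m.+1) k.
  by rewrite (newton_series_sum _ _ (uE m) (n := m.+1)) ?leqnn.
have /choice[b bE] (n : nat) : exists a : nat -> int, forall m, (m < n)%N ->
    f (u m) = \sum_(k < m.+1) newton_term sigma a (sigma m.+1) k.
  have [p pE] := fLIP _ (finite_image u (finite_II n)).
  have [a [q p_exp]] := newton_expansion sigma p n.
  exists a => m lt_mn; rewrite -pE; last by exists m.
  rewrite uE p_exp hornerD horner_sum hornerM -(@newton_sum_widen _ _ _ n) //.
  rewrite (eq_bigr _ (fun k _ => newton_term_polyE _ _ _ _)).
  (* The product in the remainder is the Newton term of index [n] with coefficient 1; it vanishes at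
     [sigma m.+1] since [m < n]. *)
  rewrite [X in _ + _ * X](_ : _ = 0) ?mulr0 ?addr0 //.
  have := newton_term_polyE sigma (fun=> 1) (sigma m.+1) n.
  by rewrite scale1r newton_term_eq0.
have uP x : exists m, x = u m.
  have [rank_gt0 xE] := rankP x; exists (rank x).-1.
  by apply: val_inj; rewrite /= -!set_valE uE prednK.
(* Diagonal choice: the first [k.+1] points already determine coefficient [k]. *)
exists (fun k => b k.+1 k); split.
  apply/funext => x; have [m ->] := uP x.
  rewrite seriesE (bE m.+1) //; apply: eq_bigr => k _.
  (* Both [b m.+1] and [b k.+1] reproduce [f] at the first [k.+1] points, as [k <= m]. *)
  rewrite /newton_term (@newton_coef_inj sigma (b m.+1) (b k.+1) k.+1) //.
  move=> [//|i] /= lt_ik.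
  by rewrite -!bE // (leq_trans lt_ik).
move=> a fE; apply/funext => k.
apply: (@newton_coef_inj sigma _ _ k.+1) => // -[//|m] /= lt_mk.
by rewrite -bE // fE seriesE.
Qed.
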